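(* Let $D,E\in\overline{\mathcal E}$ with $D\subseteq E$ and let $(D,E)$ be chain compatible. Then the chain map $\mathcal I^{DE}:\mathbb Z D\to\mathbb Z E$ gives rise to a map in homology $H(\mathcal I^{DE}):H(D)\to H(E)$. Moreover, for all $D,E,F\in\overline{\mathcal E}$ with $D\subseteq E\subseteq F$ and $(D,E)$, $(E,F)$, $(D,F)$ chain compatible, we have $$H(\mathcal I^{EF})\circ H(\mathcal I^{DE})=H(\mathcal I^{DF}).$$
   Context: Setting. $M$ is $\mathbb R^2$ or a closed surface of genus $g\ge 1$, $\omega$ is a symplectic (= area) form on $M$, $\varphi:M\to M$ is a symplectomorphism with hyperbolic fixed point $x$ (no eigenvalue of $D\varphi(x)$ has absolute value 1), with stable and unstable manifolds $W^s=\{p:\lim_{n\to\infty}\varphi^n(p)=x\}$ and $W^u=\{p:\lim_{n\to-\infty}\varphi^n(p)=x\}$ (injectively immersed curves). Assume $W^s$ and $W^u$ intersect transversely and are strongly intersecting (each of the two connected components of $W^u\setminus\{x\}$ intersects each of the two connected components of $W^s\setminus\{x\}$), and that $\varphi$ is $W$-orientation preserving (it preserves the orientations of $W^s$ and of $W^u$). Homoclinic points. $\mathcal H:=W^s\cap W^u$ (so $x\in\mathcal H$). For $p,q\in\mathcal H$ and $i\in\{s,u\}$, $[p,q]_i$ is the closed segment of $W^i$ between $p$ and $q$. The class $[p]\in\pi_1(M,x)$ is that of the loop running from $x$ through $[x,p]_u$ to $p$ and back through $[p,x]_s$ to $x$. $\mathcal H_{[x]}:=\{p\in\mathcal H: [p]=[x]\}$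 is the set of contractible homoclinic points. Maslov index. For $p,q\in\mathcal H$ with $[p]=[q]$, the relative Maslov index $\mu(p,q)\in\mathbb Z$ is twice the winding number of the unit tangent vector along the (contractible) loop from $p$ through $[p,q]_u$ to $q$ and back through $[p,q]_s$ to $p$ (computed in the universal cover, with intersections made perpendicular, and turning by $+90^\circ$ at $q$ and by $-90^\circ$ at $p$). For $p\in\mathcal H_{[x]}$ put $\mu(p):=\mu(p,x)$, $\mu(x)=0$; then $\mu(p,q)=\mu(p)-\mu(q)$. Di-gons and signs. Let $\mathbb D\subset\mathbb R^2$ be a di-gon: a polygon with exactly two vertices $(-1,0)$ and $(1,0)$, both convex, with upper boundary arc $B_s$ and lower boundary arc $B_u$. For $\mu(p,q)=1$, $\mathcal M(p,q)$ is the space of smooth orientation preserving immersions $v:\mathbb D\to M$ (immersions also on boundary and vertices) with $v(B_u)\subset W^u$, $v(B_s)\subset W^s$, $v(-1,0)=p$, $v(1,0)=q$; $\widehat{\mathcal M}(p,q)$ is its quotient by orientation preserving diffeomorphisms of $\mathbb D$ fixing the vertices. Fix an orientation $o_u$ of $W^u$ and let $o_{pq}$ be the orientation of $[p,q]_u$ from $p$ to $q$. Set $n(p,q)=+1$ if $\widehat{\mathcal M}(p,q)\ne\emptyset$ and $o_{pq}=o_u$; $n(p,q)=-1$ if $\widehat{\mathcal M}(p,q)\neq\emptyset$ and $o_{pq}\ne o_u$; $n(p,q)=0$ if $\widehat{\mathcal M}(p,q)=\emptyset$. Chain groups and homology. $\mathcal E:=\{E\subseteq\mathcal H_{[x]}: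 |E|<\infty\}$. For $E\in\mathcal E$, $E_k:=\{p\in E:\mu(p)=k\}$, and $\mathbb Z E=\bigoplus_{k}\mathbb Z E_k$ is the free abelian group generated by $E$, graded by $\mu$ ($\mathbb Z\emptyset=0$). $\partial^E=(\partial^E_k)_k$, $\partial^E_k:\mathbb Z E_k\to\mathbb Z E_{k-1}$, is the linear map with $\partial^E_k p=\sum_{q\in E_{k-1}}n(p,q)\,q$ for $p\in E_k$. $E\in\mathcal E$ is called $\partial$-complete if $\partial^E\circ\partial^E=0$; $\overline{\mathcal E}:=\{E\in\mathcal E: E\ \partial\text{-complete}\}$. For $E\in\overline{\mathcal E}$, $H(E)=\bigoplus_k H_k(E)$ with $H_k(E)=\ker\partial^E_k/\operatorname{Im}\partial^E_{k+1}$. Chain compatibility. For $D\subseteq E$ in $\mathcal E$, $\mathcal I^{DE}=(\mathcal I^{DE}_k)_k:\mathbb Z D\to\mathbb Z E$ is the (graded) inclusion. For $D,E\in\overline{\mathcal E}$ with $D\subseteq E$, the pair $(D,E)$ is chain compatible if $\mathcal I^{DE}_{k-1}\circ\partial^D_k=\partial^E_k\circ\mathcal I^{DE}_k$ for all $k\in\mathbb Z$. *)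

(* Defs.v *)
From HB Require Import structures.
From mathcomp Require Import all_boot all_order all_algebra finmap.
From mathcomp Require Import all_classical all_reals all_analysis.
From mathcomp Require Import complex.

Set Implicit Arguments.
Unset Strict Implicit.
Unset Printing Implicit Defensive.

Import Order.TTheory GRing.Theory Num.Theory.
Import numFieldNormedType.Exports.

Local Open Scope classical_set_scope.
Local Open Scope ring_scope.
Local Open Scope quotient_scope.

(** * Smooth maps between open subsets of normed spaces *)

Section Smooth.
Variable R : realType.

Fixpoint of_class_C (n : nat) (V W : normedModType R) (U : set V)
    (f : V -> W) : Prop :=
  match n with
  | 0 => {in U, continuous f}
  | m.+1 => (forall z, U z -> differentiable f z) /\
            (forall v, of_class_C m U (fun z => 'D_v f z))
  end.

Definition smooth_on (V W : normedModType R) (U : set V) (f : V -> W) : Prop :=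
  forall n, of_class_C n U f.

End Smooth.

(** * Surfaces *)

(* [coord] and [param] are total functions; only their restrictions to [dom]
   and to [coord @` dom] matter. *)
Record chart (R : realType) (T : topologicalType) := Chart {
  dom : set T;
  coord : T -> 'rV[R]_2;
  param : 'rV[R]_2 -> T }.

Definition cod (R : realType) (T : topologicalType) (c : chart R T) :
  set 'rV[R]_2 := coord c @` dom c.

Record is_chart (R : realType) (T : topologicalType) (c : chart R T) : Prop :=
  IsChart {
    chart_dom_open : open (dom c);
    chart_cod_open : open (cod c);
    chart_coordK : forall p, dom c p -> param c (coord c p) = p;
    chart_coord_cont : {in dom c, continuous (coord c)};
    chart_param_cont : {in cod c, continuous (param c)} }.

Record smooth_surface (R : realType) := SmoothSurface {
  carrier :> topologicalType;
  atlas : set (chart R carrier);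
  surface_hausdorff : hausdorff_space carrier;
  surface_second_countable : @second_countable carrier;
  atlas_charts : forall c, atlas c -> is_chart c;
  atlas_cover : forall p, exists2 c, atlas c & dom c p;
  atlas_smooth : forall c c', atlas c -> atlas c' ->
    smooth_on (coord c @` (dom c `&` dom c')) (coord c' \o param c) }.

Section Surfaces.
Variable R : realType.
Local Notation plane := 'rV[R]_2.

Definition jac_det (f : plane -> plane) (z : plane) : R := \det (jacobian f z).

Definition smooth_into (V : normedModType R) (M : smooth_surface R)
    (U : set V) (f : V -> M) : Prop :=
  {in U, continuous f} /\
  forall c, atlas c -> smooth_on (U `&` f @^-1` dom c) (coord c \o f).

Definition smooth_map (M N : smooth_surface R) (f : M -> N) : Prop :=
  forall c, atlas c -> smooth_into (cod c) (f \o param c).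

Definition smooth_to_plane (M : smooth_surface R) (f : M -> plane) : Prop :=
  forall c, atlas c -> smooth_on (cod c) (f \o param c).

Definition diffeomorphic_to_plane (M : smooth_surface R) : Prop :=
  exists (f : M -> plane) (g : plane -> M),
    [/\ cancel f g, cancel g f, smooth_to_plane f & smooth_into setT g].

(* An embedded circle in [T]. *)
Definition simple_closed_curve (T : topologicalType) (C : set T) : Prop :=
  exists g : R -> T,
    [/\ {within `[0, 1], continuous g}, g 0 = g 1,
        {in `[0, 1[ &, injective g} & C = g @` `[0, 1]].

(* There are [g] disjoint simple closed curves which together do not
   separate [T]. *)
Definition has_nonseparating (T : topologicalType) (g : nat) : Prop :=
  exists C : 'I_g -> set T,
    [/\ forall i, simple_closed_curve (C i),
        forall i j, i != j -> C i `&` C j = set0 &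
        connected (~` \bigcup_(i in [set: 'I_g]) C i)].

Definition has_genus (T : topologicalType) (g : nat) : Prop :=
  has_nonseparating T g /\ forall h, has_nonseparating T h -> (h <= g)%N.

Definition closed_surface_of_genus (M : smooth_surface R) (g : nat) : Prop :=
  [/\ compact [set: M], connected [set: M] & has_genus M g].

(* A 2-form is given by its density in each chart [c]: it evaluates on
   coordinate vectors [v], [w] as [density c z * det (v, w)].  In dimension 2
   a symplectic form is a nowhere vanishing 2-form. *)
Record symplectic_form (M : smooth_surface R) := SymplecticForm {
  density : chart R M -> plane -> R;
  density_smooth : forall c, atlas c -> smooth_on (cod c) (density c);
  density_nondeg : forall c, atlas c -> forall z, cod c z -> density c z != 0;
  density_change : forall c c', atlas c -> atlas c' ->
    forall p, dom c p -> dom c' p ->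
      density c (coord c p) =
      density c' (coord c' p) * jac_det (coord c' \o param c) (coord c p) }.

Definition preserves_form (M : smooth_surface R) (w : symplectic_form M)
    (f : M -> M) : Prop :=
  forall c c', atlas c -> atlas c' -> forall p, dom c p -> dom c' (f p) ->
    density w c (coord c p) =
    density w c' (coord c' (f p)) *
    jac_det (coord c' \o f \o param c) (coord c p).

(* [M] is oriented by [w] and the plane by its standard orientation; this
   condition entails that the differential of [f] at [z] is invertible. *)
Definition oriented_immersion_at (M : smooth_surface R) (w : symplectic_form M)
    (f : plane -> M) (z : plane) : Prop :=
  forall c, atlas c -> dom c (f z) ->
    0 < density w c (coord c (f z)) * jac_det (coord c \o f) z.

Definition hyperbolic_at (M : smooth_surface R) (f : M -> M) (x : M) : Prop :=
  forall c, atlas c -> dom c x ->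
  forall a : R[i],
    eigenvalue (map_mx (real_complex R)
      (jacobian (coord c \o f \o param c) (coord c x))) a ->
    `|a| != 1.

Definition velocity (M : smooth_surface R) (c : chart R M) (g : R -> M) (t : R)
  : plane := derive1 (coord c \o g) t.

Definition injective_immersion (M : smooth_surface R) (g : R -> M) : Prop :=
  [/\ injective g, smooth_into setT g &
      forall t c, atlas c -> dom c (g t) -> velocity c g t != 0].

Definition transverse_curves (M : smooth_surface R) (g h : R -> M) : Prop :=
  forall s t c, g s = h t -> atlas c -> dom c (g s) ->
    \det (col_mx (velocity c g s) (velocity c h t)
          : 'M[R]_(1 + 1, 2)) != 0.

Definition orientation_preserved (T : Type) (g : R -> T) (f : T -> T) : Prop :=
  forall s s' t t', s < s' -> f (g s) = g t -> f (g s') = g t' -> t < t'.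

(* For injective [g], a component of the curve minus the point [g 0]. *)
Definition branch (T : Type) (g : R -> T) (b : bool) : set T :=
  g @` [set t | if b then 0 < t else t < 0].

Definition homotopic_rel_endpoints (T : topologicalType) (f g : R -> T)
  : Prop :=
  exists H : R * R -> T,
    [/\ {within `[0, 1] `*` `[0, 1], continuous H},
        forall t, t \in `[0, 1] -> H (0, t) = f t /\ H (1, t) = g t &
        forall s, s \in `[0, 1] -> H (s, 0) = f 0 /\ H (s, 1) = f 1].

Definition covering_map (T U : topologicalType) (f : T -> U) : Prop :=
  continuous f /\
  forall y, exists V : set U,
    [/\ open V, V y &
     exists (I : Type) (S : I -> set T) (s : I -> U -> T),
       [/\ f @^-1` V = \bigcup_(i in [set: I]) S i,
           forall i j z, S i z -> S j z -> i = j,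
           forall i, open (S i) /\ {in V, continuous (s i)},
           forall i y', V y' -> S i (s i y') /\ f (s i y') = y' &
           forall i z, S i z -> s i (f z) = z]].

(* The universal cover of the surfaces considered here is the plane. *)
Definition universal_cover (M : smooth_surface R) (w : symplectic_form M)
    (f : plane -> M) : Prop :=
  [/\ covering_map f, smooth_into setT f &
      forall z, oriented_immersion_at w f z].

Definition lifts (T U : topologicalType) (f : T -> U) (g : R -> U) (h : R -> T)
  : Prop := continuous h /\ f \o h = g.

Definition vec2 (a b : R) : plane := \row_i [:: a; b]`_i.

(* [theta] is a continuous choice of angle for a unit vector tangent to the
   curve [g]. *)
Definition tangent_angle (g : R -> plane) (theta : R -> R) : Prop :=
  continuous theta /\
  forall t, exists2 r : R, r != 0 &
    derive1 g t = r *: vec2 (cos (theta t)) (sin (theta t)).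

(* The model di-gon: its two vertices have interior angle 90 degrees. *)
Definition digon : set plane :=
  [set z | `|z 0 1| <= (1 - z 0 0 ^+ 2) / 2].
Definition digon_s : set plane :=
  [set z | digon z /\ z 0 1 = (1 - z 0 0 ^+ 2) / 2].
Definition digon_u : set plane :=
  [set z | digon z /\ z 0 1 = - ((1 - z 0 0 ^+ 2) / 2)].
Definition digon_p : plane := vec2 (-1) 0.
Definition digon_q : plane := vec2 1 0.

(* Smoothness on the di-gon, boundary and vertices included, is smoothness of
   an extension to an open neighbourhood. *)
Definition digon_diffeo (h : plane -> plane) : Prop :=
  exists (h' : plane -> plane) (U U' : set plane),
    [/\ [/\ open U, digon `<=` U, open U' & digon `<=` U'],
        smooth_on U h /\ smooth_on U' h',
        h @` digon = digon /\ (forall z, digon z -> h' (h z) = z),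
        forall z, digon z -> 0 < jac_det h z &
        h digon_p = digon_p /\ h digon_q = digon_q].

End Surfaces.

(** * Homoclinic setting *)

(* The stable set of the fixed point [y] of [f]; for the inverse of [f] it is
   the unstable set. *)
Definition stable_set (T : topologicalType) (f : T -> T) (y : T) : set T :=
  [set p | iter n f p @[n --> \oo] --> y].

(* The stable and unstable manifolds are parametrized by the real line through
   the injective immersions [gs] and [gu], the parameter 0 corresponding to the
   fixed point.  The fixed orientation of the unstable manifold is the one of
   increasing parameter; the other one is obtained by replacing [gu] by
   [fun t => gu (- t)]. *)
Record homoclinic_setting (R : realType) := HomoclinicSetting {
  surf : smooth_surface R;
  surf_type : diffeomorphic_to_plane surf \/
    exists2 g, (1 <= g)%N & closed_surface_of_genus surf g;
  omega : symplectic_form surf;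
  phi : surf -> surf;
  phi_inv : surf -> surf;
  phiK : cancel phi phi_inv;
  phi_invK : cancel phi_inv phi;
  phi_smooth : smooth_map phi;
  phi_inv_smooth : smooth_map phi_inv;
  phi_symplectic : preserves_form omega phi;
  fixpt : surf;
  fixpt_fixed : phi fixpt = fixpt;
  fixpt_hyperbolic : hyperbolic_at phi fixpt;
  gs : R -> surf;
  gu : R -> surf;
  gs_immersion : injective_immersion gs;
  gu_immersion : injective_immersion gu;
  gs_range : range gs = stable_set phi fixpt;
  gu_range : range gu = stable_set phi_inv fixpt;
  gs0 : gs 0 = fixpt;
  gu0 : gu 0 = fixpt;
  W_transverse : transverse_curves gs gu;
  strongly_intersecting :
    forall b b', branch gu b `&` branch gs b' !=set0;
  W_orientation_s : orientation_preserved gs phi;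
  W_orientation_u : orientation_preserved gu phi }.

Section Homoclinic.
Variables (R : realType) (S : homoclinic_setting R).
Local Notation plane := 'rV[R]_2.
Local Notation M := (surf S).
Local Notation x := (fixpt S).

Definition Ws : set M := stable_set (@phi R S) x.
Definition Wu : set M := stable_set (@phi_inv R S) x.

Definition homoclinic : set M := Ws `&` Wu.

Definition par_s (p : M) : R := xget 0 [set t | gs S t = p].
Definition par_u (p : M) : R := xget 0 [set t | gu S t = p].

Definition loop (p : M) (t : R) : M :=
  if t <= 1 / 2 then gu S (2 * t * par_u p) else gs S ((2 - 2 * t) * par_s p).

Definition same_class (p q : M) : Prop :=
  homotopic_rel_endpoints (loop p) (loop q).

Definition contractible_homoclinic : set M :=
  [set p | homoclinic p /\ same_class p x].

(* [m] is twice the winding number of the unit tangent vector along the loop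
   [[p, q]_u], [[q, p]_s] lifted to the universal cover.  Moving a transverse
   pair of lines to a perpendicular one through transverse pairs turns the
   rotation by +90 degrees at [q] into the rotation by the angle in ]0, pi[
   from the tangent line of the lift of [Wu] to that of [Ws], and the rotation
   by -90 degrees at [p] into the one by the angle in ]-pi, 0[ from [Ws] to
   [Wu]; for perpendicular intersections these are +90 and -90 degrees. *)
Definition is_rel_maslov (p q : M) (m : int) : Prop :=
  exists (cov : plane -> M) (lu ls : R -> plane) (theta_u theta_s : R -> R)
         (dp dq : R),
    [/\ [/\ universal_cover (omega S) cov,
            lifts cov (gu S) lu & lifts cov (gs S) ls],
        lu (par_u p) = ls (par_s p) /\ lu (par_u q) = ls (par_s q),
        tangent_angle lu theta_u /\ tangent_angle ls theta_s,
        0 < dq < pi /\ theta_s (par_s q) = theta_u (par_u q) + dq &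
        0 < dp < pi /\
          theta_s (par_s p) - dp = theta_u (par_u p) + m%:~R * pi].

Definition rel_maslov (p q : M) : int := xget 0 (is_rel_maslov p q).

Definition maslov (p : M) : int := rel_maslov p x.

Definition digon_map (p q : M) (v : plane -> M) : Prop :=
  [/\ exists U : set plane,
        [/\ open U, @digon R `<=` U & smooth_into U v],
      forall z, digon z -> oriented_immersion_at (omega S) v z,
      v @` @digon_u R `<=` Wu,
      v @` @digon_s R `<=` Ws &
      v (digon_p R) = p /\ v (digon_q R) = q].

(* Two maps that agree on the di-gon are identified (take [h = id]). *)
Definition digon_equiv (v w : plane -> M) : Prop :=
  exists2 h : plane -> plane, digon_diffeo h &
    forall z, digon z -> w z = v (h z).

Definition digon_moduli (p q : M) : set (set (plane -> M)) :=
  [set C | exists2 v, digon_map p q v &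
     C = [set w | digon_map p q w /\ digon_equiv v w]].

Definition digon_sign (p q : M) : int :=
  if `[< digon_moduli p q !=set0 >] then
    if par_u p < par_u q then 1 else -1
  else 0.

End Homoclinic.

(** * Direct sums of abelian groups *)

Section DirectSum.
Variables (I : Type) (V : I -> zmodType).

Record dsum := DSum {
  dcomp :> forall i, V i;
  dcomp_finite : finite_set [set i | dcomp i != 0] }.

Lemma dsum_ext (a b : dsum) : (forall i, a i = b i) -> a = b.
Proof.
case: a b => [a a0] [b b0] /= ab.
have {}ab : a = b by apply: functional_extensionality_dep.
by case: _ / ab b0 => b0; congr DSum; exact: Prop_irrelevance.
Qed.

HB.instance Definition _ := gen_eqMixin dsum.
HB.instance Definition _ := gen_choiceMixin dsum.

Program Definition dsum_zero := @DSum (fun i => 0) _.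
Next Obligation.
by rewrite (_ : mkset _ = set0) // -subset0 => i /=; rewrite eqxx.
Qed.

Program Definition dsum_opp (a : dsum) := @DSum (fun i => - a i) _.
Next Obligation.
by move=> a; apply: sub_finite_set (dcomp_finite a) => i /=; rewrite oppr_eq0.
Qed.

Program Definition dsum_add (a b : dsum) := @DSum (fun i => a i + b i) _.
Next Obligation.
move=> a b.
apply: (@sub_finite_set _ _ ([set i | a i != 0] `|` [set i | b i != 0])).
  move=> i /=; have [->|] := eqVneq (a i) 0; last by left.
  by rewrite add0r; right.
by rewrite finite_setU; split; exact: dcomp_finite.
Qed.

Lemma dsum_addA : associative dsum_add.
Proof. by move=> a b c; apply: dsum_ext => i /=; rewrite addrA. Qed.
Lemma dsum_addC : commutative dsum_add.
Proof. by move=> a b; apply: dsum_ext => i /=; rewrite addrC. Qed.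
Lemma dsum_add0 : left_id dsum_zero dsum_add.
Proof. by move=> a; apply: dsum_ext => i /=; rewrite add0r. Qed.
Lemma dsum_addN : left_inverse dsum_zero dsum_opp dsum_add.
Proof. by move=> a; apply: dsum_ext => i /=; rewrite addNr. Qed.

HB.instance Definition _ :=
  GRing.isZmodule.Build dsum dsum_addA dsum_addC dsum_add0 dsum_addN.

End DirectSum.

(** * Chain groups and homology *)

Section Chains.
Variables (R : realType) (S : homoclinic_setting R).
Local Notation M := (surf S).
Implicit Types (D E F : {fset M}) (k l : int).

Definition admissible E : Prop :=
  [set` E] `<=` @contractible_homoclinic R S.

Definition degree_part E k : {fset M} := [fset p in E | maslov p == k]%fset.

Definition chains E k : zmodType := {ffun degree_part E k -> int}.

(* The boundary of degree [k] is [bd E k (k - 1)]; source and target degrees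
   are kept apart since [k + 1 - 1] and [k] are not convertible. *)
Definition bd E k l (c : chains E k) : chains E l :=
  [ffun q : degree_part E l =>
    \sum_(p : degree_part E k) c p * digon_sign (val p) (val q)].

Lemma bd_zmod E k l : zmod_morphism (@bd E k l).
Proof.
move=> c d; apply/ffunP => q; rewrite !ffunE -sumrB.
by apply: eq_bigr => p _; rewrite !ffunE mulrBl.
Qed.
HB.instance Definition _ E k l :=
  GRing.isZmodMorphism.Build (chains E k) (chains E l) (@bd E k l)
    (@bd_zmod E k l).

Definition bd_complete E : Prop :=
  admissible E /\
  forall k (c : chains E k), bd (k - 1 - 1) (bd (k - 1) c) = 0.

Definition chain_incl D E k (c : chains D k) : chains E k :=
  [ffun q : degree_part E k => \sum_(p : degree_part D k | val p == val q) c p].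

Definition chain_compatible D E : Prop :=
  forall k (c : chains D k),
    chain_incl E (bd (k - 1) c) = bd (k - 1) (chain_incl E c).

Definition cyc_pred E k (c : chains E k) : bool := bd (k - 1) c == 0.

Lemma cyc_zmod E k : zmod_closed (@cyc_pred E k).
Proof.
split; first by rewrite unfold_in /cyc_pred raddf0.
move=> c d; rewrite !unfold_in /cyc_pred raddfB /=.
by move=> /eqP -> /eqP ->; rewrite subrr.
Qed.
HB.instance Definition _ E k :=
  GRing.isZmodClosed.Build (chains E k) (@cyc_pred E k) (@cyc_zmod E k).

Record cycles E k := Cycle {
  cyc_val :> chains E k;
  cyc_valP : cyc_val \in @cyc_pred E k }.

HB.instance Definition _ E k := [isSub for @cyc_val E k].
HB.instance Definition _ E k := [Choice of cycles E k by <:].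
HB.instance Definition _ E k :=
  [SubChoice_isSubZmodule of cycles E k by <:].

Definition bnd_pred E k (z : cycles E k) : bool :=
  `[< exists b : chains E (k + 1), bd k b = val z >].

Lemma bnd_zmod E k : zmod_closed (@bnd_pred E k).
Proof.
split; first by apply/asboolP; exists 0; rewrite !raddf0.
move=> y z /asboolP[b bE] /asboolP[c cE]; apply/asboolP; exists (b - c).
by rewrite !raddfB /= bE cE.
Qed.
HB.instance Definition _ E k :=
  GRing.isZmodClosed.Build (cycles E k) (@bnd_pred E k) (@bnd_zmod E k).

(* For [bd_complete E] every boundary is a cycle, so this is ker / Im. *)
Definition homology_deg E k : zmodType :=
  Quotient.quot (GRing.ZmodClosed.clone (cycles E k) (@bnd_pred E k) _).

Definition hclass E k (z : cycles E k) : homology_deg E k :=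
  \pi_(homology_deg E k) z.

Definition homology E : zmodType := dsum (homology_deg E).

(* In each degree [h] maps the class of a cycle [z] to the class of the chain
   [chain_incl E z], the latter being a cycle. *)
Definition induced_by_incl D E (h : homology D -> homology E) : Prop :=
  forall (a : homology D) k (z : cycles D k), a k = hclass z ->
    exists2 w : cycles E k, val w = chain_incl E (val z) & h a k = hclass w.

End Chains.

(* Main.v *)
From HB Require Import structures.
Require Import Defs.
From mathcomp Require Import all_boot all_order all_algebra finmap.
From mathcomp Require Import all_classical all_reals all_analysis.

Import GRing.Theory.
Local Open Scope ring_scope.

(** Chain maps induce additive maps in homology, functorially, and chain
    compatibility says that the inclusion of generators is a chain map.

    It therefore sends cycles to cycles and boundaries to boundaries, so the
    class of [chain_incl E z] depends only on the class of the cycle [z]; this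
    is [hclass_incl].  Choosing representatives gives a well-defined additive
    map in every degree, and applying it degreewise to a finitely supported
    family gives the map [hmap] between the direct sums.  Since each homology
    class has a representing cycle, [induced_by_incl] determines a map.

    For functoriality, both [hEF \o hDE] and [hDF] send the class of [z] to the
    class of a cycle whose underlying chain is the image of [z]: in the first
    case after two inclusions, in the second after one.  These chains agree by
    [chain_incl_comp], so uniqueness ([induced_by_incl_uniq]) identifies the two
    maps. *)

Lemma dsum_map_finite {I : Type} {V W : I -> zmodType}
    (f : forall i, {additive V i -> W i}) (a : dsum V) :
  finite_set [set i | f i (a i) != 0]%classic.
Proof.
apply: sub_finite_set (dcomp_finite a) => i /=.
by apply: contra_neq => ->; rewrite raddf0.
Qed.

Definition dsum_map {I : Type} {V W : I -> zmodType}
    (f : forall i, {additive V i -> W i}) (a : dsum V) : dsum W :=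
  DSum (dsum_map_finite f a).

Lemma dsum_map_zmod {I : Type} {V W : I -> zmodType}
    (f : forall i, {additive V i -> W i}) :
  zmod_morphism (dsum_map f).
Proof. by move=> a b; apply: dsum_ext => i /=; rewrite raddfB. Qed.
HB.instance Definition _ (I : Type) (V W : I -> zmodType)
    (f : forall i, {additive V i -> W i}) :=
  GRing.isZmodMorphism.Build (dsum V) (dsum W) (dsum_map f) (dsum_map_zmod f).

Section InducedMap.

Context {R : realType} {S : homoclinic_setting R}.

Lemma chain_incl_zmod (D E : {fset surf S}) k :
  zmod_morphism (@chain_incl R S D E k).
Proof.
move=> c d; apply/ffunP => q; rewrite !ffunE -sumrB.
by apply: eq_bigr => p _; rewrite !ffunE.
Qed.
HB.instance Definition _ (D E : {fset surf S}) k :=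
  GRing.isZmodMorphism.Build (chains D k) (chains E k) (@chain_incl R S D E k)
    (chain_incl_zmod D E k).

(** Passing through [E] would drop the terms of [c] at generators outside [E];
    as [D `<=` E], there are none. *)
Lemma chain_incl_comp
    (D E F : {fset surf S}) k (c : chains D k) : (D `<=` E)%fset ->
  chain_incl F (chain_incl E c) = chain_incl F c.
Proof.
move=> sDE; apply/ffunP => q; rewrite !ffunE.
under eq_bigr => p _ do rewrite ffunE.
rewrite (exchange_big_dep (fun p' : degree_part D k => val p' == val q)) /=;
  last by move=> p p' /eqP <-.
apply: eq_bigr => p' p'q.
have p'E : val p' \in degree_part E k.
  by have := valP p'; rewrite !inE => /andP[/(fsubsetP sDE) -> ->].
(* The inner sum runs over the copies of [p'] in [E]: there is exactly one. *)
rewrite (big_pred1 [` p'E]%fset) // => p /=.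
rewrite -[RHS](inj_eq val_inj) /= [in RHS]eq_sym.
by have [<-|_] := eqVneq (val p') (val p); rewrite ?p'q ?andbF.
Qed.

(** [chain_compatible] fixes the target degree as [k - 1], whereas the
    boundaries divided out in degree [k] come from [bd k] on degree [k + 1],
    and [k + 1 - 1] is only provably equal to [k]. *)
Lemma chain_compatible_bd {D E : {fset surf S}} : chain_compatible D E ->
  forall k l (c : chains D k), l = k - 1 ->
    chain_incl E (bd l c) = bd l (chain_incl E c).
Proof. by move=> DE k l c ->; exact: DE. Qed.

Lemma hclass_repr {E : {fset surf S}} {k} (a : homology_deg E k) :
  hclass (repr a) = a.
Proof. exact: reprK. Qed.

Lemma hclass_zmod (E : {fset surf S}) k : zmod_morphism (@hclass R S E k).
Proof. by move=> y z; rewrite /hclass raddfB. Qed.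
HB.instance Definition _ (E : {fset surf S}) k :=
  GRing.isZmodMorphism.Build (cycles E k) (homology_deg E k) (@hclass R S E k)
    (hclass_zmod E k).

Lemma hclass_eqP {E : {fset surf S}} {k} (y z : cycles E k) :
  hclass y = hclass z <->
  exists b : chains E (k + 1), bd k b = val y - val z.
Proof.
split=> [/eqmodP | yz]; last apply/eqmodP.
  by rewrite /= Quotient.equivE => /asboolP; rewrite raddfB.
by rewrite /= Quotient.equivE; apply/asboolP; rewrite raddfB.
Qed.

Lemma incl_cycle_subproof
    {D E : {fset surf S}} (DE : chain_compatible D E) k (z : cycles D k) :
  chain_incl E (val z) \in @cyc_pred R S E k.
Proof.
rewrite unfold_in /cyc_pred -DE.
by have /eqP -> := cyc_valP z; rewrite raddf0.
Qed.

Definition incl_cycle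
    {D E : {fset surf S}} (DE : chain_compatible D E) k (z : cycles D k) :
  cycles E k := Cycle (incl_cycle_subproof DE k z).

Lemma incl_cycle_zmod {D E : {fset surf S}} (DE : chain_compatible D E) k :
  zmod_morphism (incl_cycle DE k).
Proof. by move=> y z; apply: val_inj; rewrite raddfB /= !raddfB. Qed.

(** The inclusion descends to classes because it carries a boundary [bd k b] to
    the boundary of the image of [b]. *)
Lemma hclass_incl
    {D E : {fset surf S}} (DE : chain_compatible D E) k (y z : cycles D k) :
  hclass y = hclass z ->
  hclass (incl_cycle DE k y) = hclass (incl_cycle DE k z).
Proof.
move=> /hclass_eqP[b bE]; apply/hclass_eqP; exists (chain_incl E b).
by rewrite -(chain_compatible_bd DE) ?addrK// bE raddfB.
Qed.

Definition hmap_deg {D E : {fset surf S}} (DE : chain_compatible D E) k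
    (a : homology_deg D k) : homology_deg E k :=
  hclass (incl_cycle DE k (repr a)).

Lemma hmap_deg_hclass
    {D E : {fset surf S}} (DE : chain_compatible D E) k (z : cycles D k) :
  hmap_deg DE k (hclass z) = hclass (incl_cycle DE k z).
Proof. by apply: hclass_incl; rewrite hclass_repr. Qed.

Lemma hmap_deg_zmod {D E : {fset surf S}} (DE : chain_compatible D E) k :
  zmod_morphism (hmap_deg DE k).
Proof.
move=> a b; rewrite -[a]hclass_repr -[b]hclass_repr -raddfB !hmap_deg_hclass.
by rewrite incl_cycle_zmod raddfB.
Qed.
HB.instance Definition _ (D E : {fset surf S}) (DE : chain_compatible D E) k :=
  GRing.isZmodMorphism.Build (homology_deg D k) (homology_deg E k)
    (hmap_deg DE k) (hmap_deg_zmod DE k).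

Definition hmap {D E : {fset surf S}} (DE : chain_compatible D E) :
  {additive homology D -> homology E} :=
  dsum_map (fun k => hmap_deg DE k).

Lemma hmap_induced {D E : {fset surf S}} (DE : chain_compatible D E) :
  induced_by_incl (hmap DE).
Proof.
move=> a k z az; exists (incl_cycle DE k z) => //.
by rewrite /= az hmap_deg_hclass.
Qed.

(** Every class has a representing cycle, and a cycle is determined by its
    underlying chain. *)
Lemma induced_by_incl_uniq
    {D E : {fset surf S}} (h h' : homology D -> homology E) :
  induced_by_incl h -> induced_by_incl h' -> h =1 h'.
Proof.
move=> hP h'P a; apply: dsum_ext => k.
have az := esym (hclass_repr (a k)).
have [w wE ->] := hP _ _ _ az; have [w' w'E ->] := h'P _ _ _ az.
by congr hclass; apply: val_inj; rewrite wE.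
Qed.

Lemma induced_by_incl_comp
    {D E F : {fset surf S}} (h : homology D -> homology E)
    (h' : homology E -> homology F) : (D `<=` E)%fset ->
  induced_by_incl h -> induced_by_incl h' -> induced_by_incl (h' \o h).
Proof.
move=> sDE hP h'P a k z az; have [w wE haw] := hP _ _ _ az.
have [w' w'E h'haw'] := h'P _ _ _ haw.
by exists w' => //; rewrite w'E wE chain_incl_comp.
Qed.

End InducedMap.

Theorem proposition1p3 (R : realType) (S : homoclinic_setting R) :
  (forall D E : {fset surf S},
     bd_complete D -> bd_complete E -> (D `<=` E)%fset -> chain_compatible D E ->
     exists h : {additive homology D -> homology E},
       induced_by_incl h /\
       forall h' : homology D -> homology E, induced_by_incl h' -> h' =1 h)
  /\
  (forall D E F : {fset surf S},
     bd_complete D -> bd_complete E -> bd_complete F ->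
     (D `<=` E)%fset -> (E `<=` F)%fset ->
     chain_compatible D E -> chain_compatible E F -> chain_compatible D F ->
     forall (hDE : {additive homology D -> homology E})
            (hEF : {additive homology E -> homology F})
            (hDF : {additive homology D -> homology F}),
       induced_by_incl hDE -> induced_by_incl hEF -> induced_by_incl hDF ->
       hEF \o hDE =1 hDF).
Proof.
split=> [D E _ _ _ DE | D E F _ _ _ sDE _ _ _ _ hDE hEF hDF hDEP hEFP hDFP].
  exists (hmap DE); split; first exact: hmap_induced.
  by move=> h' h'P; apply: induced_by_incl_uniq h'P (hmap_induced DE).
apply: induced_by_incl_uniq hDFP.
exact: induced_by_incl_comp hDEP hEFP.
Qed.
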